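(* Let $F$ be a field of characteristic $2$ and let $(V,q)$ be a finite-dimensional nonsingular quadratic form over $F$ that is not hyperbolic. Then $(V,q)$ is 2-algebraic if and only if $(V,q)\cong r\mathbb{H}\perp (V_a,q_a)$ for some integer $r\ge 0$ and some two-dimensional anisotropic quadratic space $(V_a,q_a)$ over $F$ that represents $1$.
   Context: $F$ is a field of characteristic $2$. A quadratic form $q$ on a finite-dimensional $F$-space is nonsingular if its associated bilinear form $b_q(x,y)=q(x+y)-q(x)-q(y)$ is nondegenerate. $\mathbb{H}$ denotes the hyperbolic plane, i.e. the form $(x,y)\mapsto xy$ on $F^2$, and $r\mathbb{H}$ is the orthogonal sum of $r$ copies of it. A nonsingular form is hyperbolic if it is isometric to $r\mathbb{H}$ for some $r\ge 0$ (the zero space counts as hyperbolic). Two nonsingular forms $q_1,q_2$ are Witt equivalent if $q_1\perp r\mathbb{H}\cong q_2\perp s\mathbb{H}$ for some $r,s\ge 0$. Second trace form: let $E/F$ be a finite separable field extension of degree $n$. For $a\in E$ write the characteristic polynomial of the $F$-linear map $x\mapsto ax$ on $E$ as $x^n-T_1(a)x^{n-1}+T_2(a)x^{n-2}+\cdots+(-1)^nT_n(a)$ (with $T_2=0$ if $n=1$). The second trace form $T_{E/F}$ is the quadratic form $(E,T_2)$ if $n$ is even, and $(E_0,T_2|_{E_0})$ with $E_0=\operatorname{Ker}T_1$ if $n$ is odd; it is nonsingular. A nonsingular quadratic form over $F$ is called 2-algebraic if it is Witt equivalent to $T_{E/F}$ for some finite separable field extension $E/F$. *)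

(* Defs.v *)
From HB Require Import structures.
From mathcomp Require Import all_boot all_order all_algebra all_field.

Set Implicit Arguments.
Unset Strict Implicit.
Unset Printing Implicit Defensive.

Import GRing.Theory.
Local Open Scope ring_scope.

Section QuadraticForms.

Variable F : fieldType.
Implicit Types V W : vectType F.

Definition polar V (q : V -> F) (x y : V) : F := q (x + y) - q x - q y.

Definition quadratic_form V (q : V -> F) : Prop :=
  (forall (a : F) (x : V), q (a *: x) = a ^+ 2 * q x) /\
  bilinear_for *%R *%R (polar q).

Definition nonsingular V (q : V -> F) : Prop :=
  quadratic_form q /\
  (forall x : V, (forall y : V, polar q x y = 0) -> x = 0).

Definition isometric V W (q : V -> F) (q' : W -> F) : Prop :=
  exists2 f : {linear V -> W}, bijective f & forall x : V, q' (f x) = q x.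

Definition orthogonal_sum V W (q : V -> F) (q' : W -> F) : (V * W)%type -> F :=
  fun x => q x.1 + q' x.2.

Definition orthogonal_copies (r : nat) V (q : V -> F) :
    {ffun 'I_r -> V} -> F :=
  fun x => \sum_(i < r) q (x i).

Definition hyperbolic_plane : (F^o * F^o)%type -> F := fun x => x.1 * x.2.

Definition hyperbolic_space (r : nat) :
    {ffun 'I_r -> (F^o * F^o)%type} -> F :=
  orthogonal_copies hyperbolic_plane.

Definition hyperbolic V (q : V -> F) : Prop :=
  exists r : nat, isometric q (@hyperbolic_space r).

Definition witt_equivalent V W (q : V -> F) (q' : W -> F) : Prop :=
  exists r s : nat,
    isometric (orthogonal_sum q (@hyperbolic_space r))
              (orthogonal_sum q' (@hyperbolic_space s)).

Definition anisotropic V (q : V -> F) : Prop := forall x : V, q x = 0 -> x = 0.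

Definition represents V (q : V -> F) (c : F) : Prop := exists x : V, q x = c.

End QuadraticForms.

Section SecondTraceForm.

Variables (F : fieldType) (E : fieldExtType F).

(* Matrix of x |-> a * x acting on row vectors of coordinates. *)
Definition mul_mx (a : E) : 'M[F]_(\dim {:E}) :=
  passmx.mxof (vbasis {:E}) (vbasis {:E}) (amull a).

(* T_i(a), the coefficients being taken with alternating signs and set to 0
   beyond the degree; thus T_2 = 0 when E has degree 1. *)
Definition char_coef (i : nat) (a : E) : F :=
  if (i <= \dim {:E})%N
  then (-1) ^+ i * (char_poly (mul_mx a))`_(\dim {:E} - i) else 0.

Fact char_coef1E (a : E) : char_coef 1 a = \tr (mul_mx a).
Proof.
have n0 : (0 < \dim {:E})%N by exact: adim_gt0.
by rewrite /char_coef n0 subn1 char_poly_trace // expr1 mulN1r opprK.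
Qed.

Fact char_coef1_is_scalar : scalar (char_coef 1).
Proof.
move=> c x y; rewrite !char_coef1E /mul_mx.
by rewrite amull_is_linear passmx.mxof_linear mxtraceD mxtraceZ.
Qed.

Definition trace_kernel : {vspace E} := lker (linfun (char_coef 1 : E -> F^o)).

(* linfun f agrees with f only for linear f, hence this check. *)
Fact mem_trace_kernel (a : E) : (a \in trace_kernel) = (char_coef 1 a == 0).
Proof.
pose h : {linear E -> F^o} := HB.pack (char_coef 1 : E -> F^o)
  (GRing.isLinear.Build F E F^o *:%R (char_coef 1) char_coef1_is_scalar).
by rewrite memv_ker -[char_coef 1]/(h : E -> F^o) lfunE.
Qed.

(* When E has even degree, the underlying space is E itself, seen as the type
   of elements of its full subspace. *)
Definition second_trace_space : {vspace E} :=
  if odd (\dim {:E}) then trace_kernel else fullv.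

Definition second_trace_form : subvs_of second_trace_space -> F :=
  fun x => char_coef 2 (vsval x).

End SecondTraceForm.

Definition two_algebraic (F : fieldType) (V : vectType F) (q : V -> F) : Prop :=
  exists E : fieldExtType F,
    separable 1%VS {:E} /\ witt_equivalent q (@second_trace_form F E).

(* Main.v *)
From HB Require Import structures.
Require Import Defs.
From mathcomp Require Import all_boot all_order all_algebra all_field ring.

(** Write [[a, b]] for the form a x^2 + x y + b y^2 and H for the hyperbolic
plane.

Why a second trace form is nearly hyperbolic.  Let T_1 and T_2 be the first
two characteristic coefficients of E/F.  The polar form of T_2 is
T_1(x) T_1(y) - T_1(x y), so separability, in the guise of the nondegeneracy
of the trace, makes the second trace form nonsingular.  In characteristic 2
the Frobenius map s(x) = x^2 of E satisfies T_1(s x) = T_1(x)^2 and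
T_2(s x) = T_2(x)^2; it therefore squares both the quadratic form and its
polar form, and sends a symplectic basis to a symplectic basis.  Computed in
the image basis, the second trace form is an orthogonal sum of planes
[[a^2, b^2]].  Each of these is isometric to [[1, ab]], and
[[1, c]] + [[1, d]] is isometric to [[1, c + d]] + H.  Hence the form is 0 or
[[1, c]] + m H for some c: this is [frobenius_classification], applied to E in
[second_trace_classification].

From there to the theorem.  If q is Witt equivalent to a second trace form,
cancelling hyperbolic planes ([witt_cancel]) leaves q isometric to
[[1, c]] + k H, unless q is hyperbolic; and [[1, c]] is anisotropic, since
otherwise it is H and q is hyperbolic again.  Conversely a nonsingular plane
representing 1 is some [[1, c]]; when it is anisotropic, X^2 + X + c is
irreducible and separable, and [[1, c]] is the norm form, that is the second
trace form, of the quadratic extension that it defines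
([artin_schreier_extension]).

The facts on T_1 and T_2 are proved for matrices, through the reversed
characteristic polynomial det(1 - X A): its multiplicativity modulo X^3 gives
the polar form of T_2, and det(1 - X A)^2 = det(1 - X^2 A^2) in characteristic
2 gives the compatibility with squares.  The trace of a separable extension is
nonzero because the derivative of a characteristic polynomial is a linear
combination of traces of powers. *)

Set Implicit Arguments.
Unset Strict Implicit.
Unset Printing Implicit Defensive.

Import GRing.Theory.
Local Open Scope ring_scope.

(** * Polar forms and isometries *)

Section Polar.

Variables (F : fieldType) (V : vectType F) (q : V -> F).

Lemma polarC x y : polar q x y = polar q y x.
Proof. by rewrite /polar (addrC x) addrAC. Qed.

Lemma quadratic_formI :
    (forall a x, q (a *: x) = a ^+ 2 * q x) ->
    (forall a x y z, polar q (a *: x + y) z = a * polar q x z + polar q y z) ->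
  quadratic_form q.
Proof.
move=> qZ qB; split=> //; split=> [z|x] a y z'; first exact: qB.
by rewrite polarC qB !(polarC x).
Qed.

Hypothesis qquad : quadratic_form q.

Lemma quadZ a x : q (a *: x) = a ^+ 2 * q x.
Proof. exact: qquad.1. Qed.

Lemma quad0 : q 0 = 0.
Proof. by rewrite -(scale0r 0) quadZ expr0n mul0r. Qed.

Lemma quadD x y : q (x + y) = q x + q y + polar q x y.
Proof. by rewrite /polar; ring. Qed.

Lemma polarP a x y z : polar q (a *: x + y) z = a * polar q x z + polar q y z.
Proof. exact: qquad.2.1. Qed.

Lemma polarDl x y z : polar q (x + y) z = polar q x z + polar q y z.
Proof. by have := polarP 1 x y z; rewrite scale1r mul1r. Qed.

Lemma polar0l z : polar q 0 z = 0.
Proof. by apply: (@addrI _ (polar q 0 z)); rewrite -polarDl !addr0. Qed.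

Lemma polarZl a x z : polar q (a *: x) z = a * polar q x z.
Proof. by have := polarP a x 0 z; rewrite polar0l !addr0. Qed.

Lemma polarDr x y z : polar q z (x + y) = polar q z x + polar q z y.
Proof. by rewrite !(polarC z) polarDl. Qed.

Lemma polarZr a x z : polar q z (a *: x) = a * polar q z x.
Proof. by rewrite !(polarC z) polarZl. Qed.

Lemma polarxx x : polar q x x = q x *+ 2.
Proof.
by rewrite /polar -mulr2n -scaler_nat quadZ; ring.
Qed.

End Polar.

Section Isometry.

Variable F : fieldType.
Implicit Types U V W : vectType F.

Lemma isometricI V W (q : V -> F) (q' : W -> F) (f : V -> W) (g : W -> V) :
    linear f -> cancel f g -> cancel g f -> (forall x, q' (f x) = q x) ->
  isometric q q'.
Proof.
move=> lf fK gK fq.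
pose h : {linear V -> W} := HB.pack f (GRing.isLinear.Build F V W *:%R f lf).
by exists h => //; exists g.
Qed.

Lemma isometric_refl V (q : V -> F) : isometric q q.
Proof. by apply: (@isometricI _ _ _ _ id id). Qed.

Lemma isometric_sym V W (q : V -> F) (q' : W -> F) :
  isometric q q' -> isometric q' q.
Proof.
case=> f [g fK gK] fq; apply: (@isometricI _ _ _ _ g f) => //.
  exact: can2_linear fK gK.
by move=> x; rewrite -fq gK.
Qed.

Lemma isometric_trans U V W (q : U -> F) (q' : V -> F) (q'' : W -> F) :
  isometric q q' -> isometric q' q'' -> isometric q q''.
Proof.
move=> [f [g fK gK] fq] [f' [g' fK' gK'] fq'].
apply: (@isometricI _ _ _ _ (f' \o f) (g \o g')).
- by move=> a x y /=; rewrite !linearP.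
- exact: can_comp.
- exact: can_comp.
- by move=> x /=; rewrite fq' fq.
Qed.

Lemma isometric_sum V V' W W' (q1 : V -> F) (q1' : V' -> F)
    (q2 : W -> F) (q2' : W' -> F) :
  isometric q1 q1' -> isometric q2 q2' ->
  isometric (orthogonal_sum q1 q2) (orthogonal_sum q1' q2').
Proof.
move=> [f [g fK gK] fq] [f' [g' fK' gK'] fq'].
apply: (@isometricI _ _ _ _ (fun x => (f x.1, f' x.2)) (fun x => (g x.1, g' x.2))).
- by move=> a x y /=; rewrite !linearP.
- by case=> x y /=; rewrite fK fK'.
- by case=> x y /=; rewrite gK gK'.
- by case=> x y; rewrite /orthogonal_sum /= fq fq'.
Qed.

Lemma isometric_sumC V W (q : V -> F) (q' : W -> F) :
  isometric (orthogonal_sum q q') (orthogonal_sum q' q).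
Proof.
apply: (@isometricI _ _ _ _ (fun x => (x.2, x.1)) (fun x => (x.2, x.1))) => //.
- by case.
- by case.
- by case=> x y; rewrite /orthogonal_sum /= addrC.
Qed.

Lemma isometric_sumA U V W (q : U -> F) (q' : V -> F) (q'' : W -> F) :
  isometric (orthogonal_sum q (orthogonal_sum q' q''))
            (orthogonal_sum (orthogonal_sum q q') q'').
Proof.
apply: (@isometricI _ _ _ _ (fun x => ((x.1, x.2.1), x.2.2))
                            (fun x => (x.1.1, (x.1.2, x.2)))) => //.
- by case=> x [].
- by case=> [[]].
- by case=> x [y z]; rewrite /orthogonal_sum /= addrA.
Qed.

Lemma vect_dim0 V : dim V = 0%N -> forall x : V, x = 0.
Proof.
move=> V0 x; have: \dim {:V} == 0 by rewrite dimvf V0.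
by rewrite dimv_eq0 => /eqP V0'; have := memvf x; rewrite V0' memv0 => /eqP.
Qed.

Lemma isometric_dim0 V W (q : V -> F) (q' : W -> F) :
    quadratic_form q -> quadratic_form q' -> dim V = 0%N -> dim W = 0%N ->
  isometric q q'.
Proof.
move=> qq qq' V0 W0; have V1 := vect_dim0 V0; have W1 := vect_dim0 W0.
apply: (isometricI (f := fun _ => 0) (g := fun _ => 0)) => [a x y|x|x|x].
- by rewrite scaler0 addr0.
- by rewrite (V1 x).
- by rewrite (W1 x).
- by rewrite (V1 x) !quad0.
Qed.

Lemma isometric_sum0l V W (q : V -> F) (q' : W -> F) :
  quadratic_form q -> dim V = 0%N -> isometric (orthogonal_sum q q') q'.
Proof.
move=> qq V0; have V1 := vect_dim0 V0.
apply: (@isometricI _ _ _ _ (fun x => x.2) (fun x => (0, x))) => //.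
  by case=> x y; rewrite (V1 x).
by case=> x y; rewrite /orthogonal_sum /= (V1 x) quad0 // add0r.
Qed.

Lemma isometric_dim V W (q : V -> F) (q' : W -> F) :
  isometric q q' -> dim V = dim W.
Proof.
case=> f [g fK gK] _; rewrite -!dimvf.
have kf : lker (linfun f) == 0%VS.
  by apply/lker0P=> x y; rewrite !lfunE; apply: (can_inj fK).
rewrite -(limg_dim_eq (f := linfun f)); last by rewrite (eqP kf) capv0.
congr (\dim _); apply/eqP; rewrite eqEsubv subvf; apply/subvP => x _.
by rewrite -(gK x) -[f (g x)](lfunE f) memv_img ?memvf.
Qed.

Lemma isometric_quad V W (q : V -> F) (q' : W -> F) :
  isometric q q' -> quadratic_form q -> quadratic_form q'.
Proof.
move/isometric_sym=> [f _ fq] qq; have fP x y : polar q' x y = polar q (f x) (f y).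
  by rewrite /polar -!fq linearD.
apply: quadratic_formI => [a x|a x y z]; first by rewrite -!fq linearZ quadZ.
by rewrite !fP linearP polarP.
Qed.

Lemma isometric_nonsingular V W (q : V -> F) (q' : W -> F) :
  isometric q q' -> nonsingular q -> nonsingular q'.
Proof.
move=> qq' [qq qn]; split; first exact: isometric_quad qq' qq.
case/isometric_sym: qq' => f [g fK gK] fq x x0.
have fP u v : polar q' u v = polar q (f u) (f v).
  by rewrite /polar -!fq linearD.
apply: (can_inj fK); rewrite linear0; apply: qn => y.
by rewrite -(gK y) -fP x0.
Qed.

(** Injectivity is free: the kernel of a form-preserving map lies in the radical
of the source. *)
Lemma isometric_embedding V W (q : V -> F) (q' : W -> F) (f : V -> W) :
    linear f -> nonsingular q -> dim V = dim W -> (forall x, q' (f x) = q x) ->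
  isometric q q'.
Proof.
move=> lf [qq qn] dVW fq.
pose h : {linear V -> W} := HB.pack f (GRing.isLinear.Build F V W *:%R f lf).
have q'0 : q' 0 = 0 by rewrite -(linear0 h) [LHS]fq quad0.
have kf : lker (linfun h) == 0%VS.
  apply/lker0P=> x y; rewrite !lfunE => hxy; apply/eqP; rewrite -subr_eq0.
  apply/eqP/qn => z; rewrite /polar -!fq -![f _]/(h _) linearD linearB hxy /=.
  by rewrite subrr add0r q'0 subr0 subrr.
have imf : limg (linfun h) = fullv.
  apply/eqP; rewrite eqEdim subvf /= limg_dim_eq ?(eqP kf) ?capv0 //.
  by rewrite !dimvf dVW.
apply: (isometricI (f := linfun h) (g := (linfun h)^-1%VF)).
- by move=> a x y; rewrite linearP.
- exact: lker0_lfunK.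
- by move=> x; rewrite limg_lfunVK // imf memvf.
- by move=> x; rewrite lfunE /= fq.
Qed.

Lemma polar_sum V W (q : V -> F) (q' : W -> F) x y :
  polar (orthogonal_sum q q') x y = polar q x.1 y.1 + polar q' x.2 y.2.
Proof. by rewrite /polar /orthogonal_sum /=; ring. Qed.

Lemma sum_quad V W (q : V -> F) (q' : W -> F) :
  quadratic_form q -> quadratic_form q' ->
  quadratic_form (orthogonal_sum q q').
Proof.
move=> qq qq'; apply: quadratic_formI => [a x|a x y z].
  by rewrite /orthogonal_sum /= !quadZ // mulrDr.
by rewrite !polar_sum /= !polarP //; ring.
Qed.

Lemma sum_nonsingular V W (q : V -> F) (q' : W -> F) :
    quadratic_form q -> quadratic_form q' ->
  nonsingular (orthogonal_sum q q') <-> nonsingular q /\ nonsingular q'.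
Proof.
move=> qq qq'; have sq := sum_quad qq qq'; split=> [[_ sn]|[[_ qn] [_ qn']]].
  split; split=> // x x0.
    suff: (x, 0) = 0 :> (V * W)%type by case.
    by apply: sn => y; rewrite polar_sum /= x0 polar0l // addr0.
  suff: (0, x) = 0 :> (V * W)%type by case.
  by apply: sn => y; rewrite polar_sum /= x0 polar0l // addr0.
split=> // [[x y]] xy0; congr (_, _).
  by apply: qn => u; have := xy0 (u, 0); rewrite polar_sum /= (polarC _ y) polar0l // addr0.
by apply: qn' => u; have := xy0 (0, u); rewrite polar_sum /= (polarC _ x) polar0l // add0r.
Qed.

Lemma hyperbolic_plane_quad : quadratic_form (@hyperbolic_plane F).
Proof.
apply: quadratic_formI => [a x|a x y z]; rewrite /polar /hyperbolic_plane /=;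
  rewrite -?[_ *: _]/(_ * _); ring.
Qed.

Lemma hyperbolic_space_quad r : quadratic_form (@hyperbolic_space F r).
Proof.
have pE x y : polar (@hyperbolic_space F r) x y =
    \sum_i polar (@hyperbolic_plane F) (x i) (y i).
  rewrite /polar /hyperbolic_space /orthogonal_copies -!sumrB.
  by apply: eq_bigr => i _; rewrite ffunE.
apply: quadratic_formI => [a x|a x y z].
  rewrite /hyperbolic_space /orthogonal_copies mulr_sumr.
  by apply: eq_bigr => i _; rewrite ffunE quadZ //; apply: hyperbolic_plane_quad.
rewrite !pE mulr_sumr -big_split; apply: eq_bigr => i _ /=.
by rewrite !ffunE polarP //; apply: hyperbolic_plane_quad.
Qed.

Lemma hyperbolic_space_dim r : dim {ffun 'I_r -> (F^o * F^o)%type} = (r * 2)%N.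
Proof. by rewrite /dim /= card_ord. Qed.

Lemma hyperbolic_spaceS r :
  isometric (orthogonal_sum (@hyperbolic_plane F) (@hyperbolic_space F r))
            (@hyperbolic_space F r.+1).
Proof.
pose H := (F^o * F^o)%type.
pose f (x : (H * {ffun 'I_r -> H})%type) : {ffun 'I_r.+1 -> H} :=
  [ffun i => if unlift ord0 i is Some j then x.2 j else x.1].
pose g (x : {ffun 'I_r.+1 -> H}) : (H * {ffun 'I_r -> H})%type :=
  (x ord0, [ffun j => x (lift ord0 j)]).
apply: (isometricI (f := f) (g := g)); rewrite {}/f {}/g.
- move=> a x y; apply/ffunP=> i; rewrite !ffunE.
  by case: unliftP => [j _|_] //; rewrite !ffunE.
- case=> x y /=; rewrite ffunE unlift_none; congr (_, _).
  by apply/ffunP=> j; rewrite !ffunE liftK.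
- move=> x; apply/ffunP=> i; rewrite !ffunE /=.
  by case: unliftP => [j ->|->] //; rewrite ffunE.
- move=> [x y]; rewrite /hyperbolic_space /orthogonal_copies big_ord_recl.
  rewrite /orthogonal_sum ffunE unlift_none; congr (_ + _).
  by apply: eq_bigr => i _; rewrite ffunE liftK.
Qed.

Lemma isometric_sum_hyperbolic0 V (q : V -> F) :
  isometric q (orthogonal_sum q (@hyperbolic_space F 0)).
Proof.
apply: isometric_sym; apply: isometric_trans (isometric_sumC _ _) _.
by apply: isometric_sum0l; [apply: hyperbolic_space_quad|rewrite hyperbolic_space_dim].
Qed.

Lemma hyperbolic_spaceD r s :
  isometric (orthogonal_sum (@hyperbolic_space F r) (@hyperbolic_space F s))
            (@hyperbolic_space F (r + s)).
Proof.
elim: r => [|r IHr].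
  by apply: isometric_sum0l; [apply: hyperbolic_space_quad|rewrite hyperbolic_space_dim].
apply: isometric_trans (hyperbolic_spaceS _).
apply: isometric_trans (isometric_sum (isometric_refl _) IHr).
apply: isometric_trans (isometric_sym (isometric_sumA _ _ _)).
apply: isometric_sum (isometric_refl _).
exact/isometric_sym/hyperbolic_spaceS.
Qed.

End Isometry.

(** * Cancellation of hyperbolic planes *)

Section Cancellation.

Variable F : fieldType.
Implicit Types U V W : vectType F.

(** Naming the complement by an isometric embedding of [W], not by its image,
lets one and the same [W] be the complement of several pairs. *)
Definition orthogonal_complement W U (qW : W -> F) (q : U -> F) (e f : U) :=
  exists j : {linear W -> U},
    [/\ injective j, forall w, q (j w) = qW w
      & forall u, polar q u e = 0 /\ polar q u f = 0 <-> exists w, u = j w].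

Section Moves.

Variables (U W : vectType F) (q : U -> F) (qW : W -> F).
Hypothesis qq : quadratic_form q.

Lemma isotropic_polar e : q e = 0 -> polar q e e = 0.
Proof. by move=> e0; rewrite polarxx // e0 mul0rn. Qed.

Lemma complement_swap e f :
  orthogonal_complement qW q e f -> orthogonal_complement qW q f e.
Proof.
by case=> j [ji jq jE]; exists j; split=> // u; rewrite -jE; split=> -[].
Qed.

Lemma complement_scale e f a b : a != 0 -> b != 0 ->
  orthogonal_complement qW q e f -> orthogonal_complement qW q (a *: e) (b *: f).
Proof.
move=> a0 b0 [j [ji jq jE]]; exists j; split=> // u; rewrite -jE !polarZr //.
split=> [[/eqP ue /eqP uf]|[-> ->]]; last by rewrite !mulr0.
by move: ue uf; rewrite !mulf_eq0 (negPf a0) (negPf b0) => /eqP-> /eqP->.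
Qed.

(** The map w |-> w - b(w, f') e fixes e, preserves q on the orthogonal of e
because e is isotropic, and makes w orthogonal to f' instead of f. *)
Lemma complement_move e f f' :
    q e = 0 -> polar q e f = 1 -> polar q e f' = 1 ->
  orthogonal_complement qW q e f -> orthogonal_complement qW q e f'.
Proof.
move=> e0 ef ef' [j [ji jq jE]]; have ee := isotropic_polar e0.
have je w : polar q (j w) e = 0 by apply: proj1 ((jE (j w)).2 _); exists w.
have jf w : polar q (j w) f = 0 by apply: proj2 ((jE (j w)).2 _); exists w.
pose k w := j w - polar q (j w) f' *: e.
have lk : linear k.
  move=> a x y; rewrite /k linearP polarP // scalerDl -scalerA scalerBr.
  by rewrite addrACA -opprD.
pose h : {linear W -> U} := HB.pack k (GRing.isLinear.Build F W U *:%R k lk).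
exists h; split.
- apply: raddf_inj => w /=; rewrite /k => /eqP; rewrite subr_eq0 => /eqP jw.
  have := jf w; rewrite {1}jw polarZl // ef mulr1 => c0.
  by apply: ji; rewrite linear0 jw c0 scale0r.
- move=> w /=; rewrite quadD // -scaleNr quadZ // polarZr // je e0.
  by rewrite !mulr0 !addr0.
- move=> u; split=> [[ue uf']|[w ->]].
    have [w jw] : exists w, u - polar q u f *: e = j w.
      apply/jE; rewrite !polarDl // -scaleNr !polarZl //.
      by rewrite ue ee ef mulr0 addr0 mulr1 subrr.
    exists w; rewrite /= /k -jw polarDl // uf' -scaleNr polarZl // ef'.
    by rewrite mulr1 add0r !scaleNr opprK subrK.
  rewrite /= /k !polarDl // -scaleNr !polarZl // je ee ef' mulr0 addr0 mulr1.
  by rewrite subrr.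
Qed.

(** The partner of [e] is existential because, by [complement_move], all its
partners have the same complements. *)
Definition splits_off e :=
  q e = 0 /\ exists2 f, polar q e f = 1 & orthogonal_complement qW q e f.

(** Exchange the partner of e for a multiple of z, then let z take the place of
e. *)
Lemma splits_off_step e z :
  splits_off e -> q z = 0 -> polar q e z != 0 -> splits_off z.
Proof.
move=> [e0 [f ef efW]] z0 ez; split=> //; exists ((polar q e z)^-1 *: e).
  by rewrite polarZr // (polarC _ z) mulVf.
have ez' : orthogonal_complement qW q e ((polar q e z)^-1 *: z).
  by apply: complement_move efW => //; rewrite polarZr // mulVf.
have := complement_swap (complement_scale (invr_neq0 ez) ez ez').
by rewrite scalerA mulfV // scale1r.
Qed.

(** When b(e, e') <> 0 one exchange leads from e to e'; otherwise an isotropic z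
orthogonal to neither serves as an intermediate step. *)
Lemma splits_off_any e e' f' :
  splits_off e -> q e' = 0 -> q f' = 0 -> polar q e' f' = 1 ->
  orthogonal_complement qW q e' f'.
Proof.
move=> se e0' f0' ef'.
suff [_ [f ef efW]] : splits_off e' by exact: complement_move efW.
have [ee'|ee'] := eqVneq (polar q e e') 0; last exact: splits_off_step se _ ee'.
have [e0 [f ef _]] := se.
(* One of f', f and f + f' is orthogonal to neither e nor e'. *)
have [y ey e'y] : exists2 y, polar q e y != 0 & polar q e' y != 0.
  have [ef0|ef0] := eqVneq (polar q e f') 0; last first.
    by exists f' => //; rewrite ef' oner_neq0.
  have [fe0|fe0] := eqVneq (polar q e' f) 0; last first.
    by exists f => //; rewrite ef oner_neq0.
  exists (f + f'); rewrite polarDr // ?ef ?ef0 ?fe0 ?ef' ?add0r ?addr0;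
    exact: oner_neq0.
(* Moving y along e makes it isotropic. *)
pose z := y - (q y / polar q e y) *: e.
have ez : polar q e z != 0.
  by rewrite polarDr // -scaleNr polarZr // isotropic_polar // mulr0 addr0.
have e'z : polar q z e' != 0.
  by rewrite polarC polarDr // -scaleNr polarZr // (polarC q e' e) ee' mulr0 addr0.
have z0 : q z = 0.
  rewrite quadD // -scaleNr quadZ // e0 polarZr // (polarC _ y) mulr0 addr0.
  by rewrite mulNr mulfVK // subrr.
exact: splits_off_step (splits_off_step se z0 ez) e0' e'z.
Qed.

End Moves.

Lemma complement_unique U W W' (q : U -> F) (qW : W -> F) (qW' : W' -> F) e f :
    orthogonal_complement qW q e f -> orthogonal_complement qW' q e f ->
  isometric qW qW'.
Proof.
move=> [j [ji jq jE]] [j' [ji' jq' jE']].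
pose g := (linfun j)^-1%VF; pose g' := (linfun j')^-1%VF.
have gK : cancel j g.
  move=> x; rewrite -[j x]lfunE; apply/lker0_lfunK/lker0P => u v.
  by rewrite !lfunE; apply: ji.
have gK' : cancel j' g'.
  move=> x; rewrite -[j' x]lfunE; apply/lker0_lfunK/lker0P => u v.
  by rewrite !lfunE; apply: ji'.
have jg w : j' (g' (j w)) = j w.
  have [w' ->] : exists w', j w = j' w' by apply/jE'/jE; exists w.
  by rewrite gK'.
have jg' w : j (g (j' w)) = j' w.
  have [w' ->] : exists w', j' w = j w' by apply/jE/jE'; exists w.
  by rewrite gK.
apply: (isometricI (f := g' \o j) (g := g \o j')) => /=.
- by move=> a x y /=; rewrite !linearP.
- by move=> x /=; rewrite jg gK.
- by move=> x /=; rewrite jg' gK'.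
- by move=> x; rewrite -jq' jg jq.
Qed.

(** Both [V] and [W] are complements of hyperbolic pairs of one space, and these
pairs have the same complements. *)
Lemma witt_cancel_plane V W (q : V -> F) (q' : W -> F) :
    quadratic_form q -> quadratic_form q' ->
    isometric (orthogonal_sum (@hyperbolic_plane F) q)
              (orthogonal_sum (@hyperbolic_plane F) q') ->
  isometric q q'.
Proof.
move=> qq qq' /isometric_sym[g [g' gK gK'] gq].
have hq := hyperbolic_plane_quad F.
set Q := orthogonal_sum _ q in gq; set Q' := orthogonal_sum _ q' in gq.
have QQ : quadratic_form Q := sum_quad hq qq.
pose E : (F^o * F^o)%type := (1, 0); pose E' : (F^o * F^o)%type := (0, 1).
have EE' : polar (@hyperbolic_plane F) E E' = 1.
  by rewrite /polar /hyperbolic_plane /=; ring.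
have polE (x : (F^o * F^o)%type) :
  polar (@hyperbolic_plane F) x E = x.2 /\ polar (@hyperbolic_plane F) x E' = x.1.
  by split; rewrite /polar /hyperbolic_plane /=; ring.
have planeW (X : vectType F) (r : X -> F) : quadratic_form r ->
    orthogonal_complement r (orthogonal_sum (@hyperbolic_plane F) r) (E, 0) (E', 0).
  move=> rq; pose j (x : X) : ((F^o * F^o) * X)%type := (0, x).
  have lj : linear j by move=> a x y; congr (_, _); rewrite /= scaler0 addr0.
  exists (HB.pack_for {linear X -> ((F^o * F^o) * X)%type} j
            (GRing.isLinear.Build F X _ *:%R j lj)) => /=; split.
  - by move=> x y [].
  - by move=> w; rewrite /orthogonal_sum /hyperbolic_plane /= mulr0 add0r.
  - move=> [[x y] w]; rewrite !polar_sum /= !(polarC r w) !polar0l // !addr0.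
    rewrite !(proj1 (polE _)) !(proj2 (polE _)) /=.
    by split=> [[-> ->]|[w' [-> -> _]]]; first by exists w.
have gP u v : polar Q (g u) (g v) = polar Q' u v by rewrite /polar -!gq linearD.
apply: (@complement_unique _ _ _ Q q q' (E, 0) (E', 0)); first exact: planeW.
apply: (@splits_off_any _ _ Q q' QQ (g (E, 0)) (E, 0) (E', 0)).
- split.
    by rewrite gq /Q' /orthogonal_sum /hyperbolic_plane /= mulr0 quad0 // addr0.
  exists (g (E', 0)).
    by rewrite gP polar_sum /= EE' polar0l // addr0.
  have := planeW W q' qq'; rewrite -/Q' => -[j [ji jq jE]].
  exists (g \o j); split=> /=.
  - by apply: inj_comp ji; apply: can_inj gK.
  - by move=> w; rewrite gq jq.
  - move=> u; rewrite -(gK' u) !gP jE; split=> -[w]; first by move=> ->; exists w.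
    by move/(can_inj gK) => ->; exists w.
- by rewrite /Q /orthogonal_sum /hyperbolic_plane /= mulr0 quad0 // addr0.
- by rewrite /Q /orthogonal_sum /hyperbolic_plane /= mul0r quad0 // addr0.
- by rewrite polar_sum /= EE' polar0l // addr0.
Qed.

Lemma witt_cancel r V W (q : V -> F) (q' : W -> F) :
    quadratic_form q -> quadratic_form q' ->
    isometric (orthogonal_sum (@hyperbolic_space F r) q)
              (orthogonal_sum (@hyperbolic_space F r) q') ->
  isometric q q'.
Proof.
move=> qq qq'; elim: r => [|r IHr] iqq'.
  have H0 (X : vectType F) (s : X -> F) :
      isometric (orthogonal_sum (@hyperbolic_space F 0) s) s.
    by apply: isometric_sum0l; [exact: hyperbolic_space_quad|rewrite hyperbolic_space_dim].
  exact: isometric_trans (isometric_sym (H0 _ q)) (isometric_trans iqq' (H0 _ q')).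
apply: IHr; have hq := hyperbolic_space_quad F r.
apply: witt_cancel_plane; [exact: sum_quad|exact: sum_quad|].
have HS (X : vectType F) (s : X -> F) :
    isometric (orthogonal_sum (@hyperbolic_plane F) (orthogonal_sum (@hyperbolic_space F r) s))
      (orthogonal_sum (@hyperbolic_space F r.+1) s).
  apply: isometric_trans (isometric_sumA _ _ _) _.
  exact: isometric_sum (hyperbolic_spaceS _ _) (isometric_refl _).
apply: isometric_trans (HS _ q) _.
exact: isometric_trans iqq' (isometric_sym (HS _ q')).
Qed.

End Cancellation.

(** * Binary forms in characteristic 2 *)

Section CharTwo.

Variable F : fieldType.
Hypothesis charF2 : 2%N \in [pchar F].
Implicit Types U V W : vectType F.

Let two0 : 2%:R = 0 :> F := pcharf0 charF2.

Local Notation plane := (F^o * F^o)%type.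

(** The form usually written [[a, b]]. *)
Definition binary_form (a b : F) : plane -> F :=
  fun x => a * x.1 ^+ 2 + x.1 * x.2 + b * x.2 ^+ 2.

Lemma polar_binary a b x y :
  polar (binary_form a b) x y = x.1 * y.2 + x.2 * y.1.
Proof. by rewrite /polar /binary_form /=; ring: two0. Qed.

Lemma binary_form_quad a b : quadratic_form (binary_form a b).
Proof.
apply: quadratic_formI => [c x|c x y z]; rewrite ?polar_binary /binary_form /=;
  rewrite -?[_ *: _]/(_ * _); ring.
Qed.

Lemma binary_form_nonsingular a b : nonsingular (binary_form a b).
Proof.
split=> [|[x y] xy0]; first exact: binary_form_quad.
congr (_, _); [have := xy0 (0, 1)|have := xy0 (1, 0)];
  by rewrite polar_binary /= mulr0 mulr1 ?addr0 ?add0r.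
Qed.

Lemma polar_alt V (q : V -> F) x : quadratic_form q -> polar q x x = 0.
Proof. by move=> qq; rewrite polarxx // -mulr_natr two0 mulr0. Qed.

(** Let e, f be the standard basis of the plane on the right.  If a <> 0, the
vector e / a has value 1 and a f + b e, which pairs to 1 with it, has value a b
modulo 2.  If a = 0, both forms are hyperbolic planes. *)
Lemma binary_form_squares a b :
  isometric (binary_form 1 (a * b)) (binary_form (a ^+ 2) (b ^+ 2)).
Proof.
have [->|a0] := eqVneq a 0.
  apply: (isometricI
    (f := fun x : plane => (x.1 + x.2 + b ^+ 2 * x.1, x.1) : plane)
    (g := fun x : plane => (x.2, x.1 - x.2 - b ^+ 2 * x.2) : plane)).
  - by move=> c x y /=; congr (_, _) => /=; rewrite -?[_ *: _]/(_ * _); ring.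
  - by case=> x y /=; congr (_, _); ring.
  - by case=> x y /=; congr (_, _); ring.
  - by case=> x y /=; rewrite /binary_form /=; ring: two0.
apply: (isometricI
  (f := fun x : plane => (a^-1 * x.1 + b * x.2, a * x.2) : plane)
  (g := fun x : plane => (a * (x.1 - b * (a^-1 * x.2)), a^-1 * x.2) : plane)).
- by move=> c x y /=; congr (_, _) => /=; rewrite -?[_ *: _]/(_ * _); ring.
- by case=> x y /=; congr (_, _); field.
- by case=> x y /=; congr (_, _); field.
- case=> x y /=; rewrite /binary_form /=.
  have aa : a * a^-1 = 1 by rewrite mulfV.
  by ring: two0 aa.
Qed.

(** With bases e, f and e', f' of the two planes on the right, e, f + f' spans
[[1, c + d]] and is orthogonal to the hyperbolic pair e + e',
f' + d (e + e'). *)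
Lemma binary_form_add c d :
  isometric (orthogonal_sum (binary_form 1 (c + d)) (@hyperbolic_plane F))
            (orthogonal_sum (binary_form 1 c) (binary_form 1 d)).
Proof.
pose f (x : (plane * plane)%type) : (plane * plane)%type :=
  ((x.1.1 + x.2.1 + d * x.2.2, x.1.2), (x.2.1 + d * x.2.2, x.1.2 + x.2.2)).
pose g (x : (plane * plane)%type) : (plane * plane)%type :=
  ((x.1.1 - x.2.1, x.1.2), (x.2.1 - d * (x.2.2 - x.1.2), x.2.2 - x.1.2)).
apply: (isometricI (f := f) (g := g)); rewrite {}/f {}/g.
- by move=> a x y /=; congr ((_, _), (_, _)) => /=; rewrite -?[_ *: _]/(_ * _); ring.
- by case=> [[x y] [u v]] /=; congr ((_, _), (_, _)); ring.
- by case=> [[x y] [u v]] /=; congr ((_, _), (_, _)); ring.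
- case=> [[x y] [u v]].
  rewrite /orthogonal_sum /binary_form /hyperbolic_plane /=.
  pose s := u + d * v; pose t := x * s + s ^+ 2 + s * y + d * y * v + d * v ^+ 2.
  by rewrite -[RHS]addr0 -(mul0r t) -two0 /t /s; ring.
Qed.

(** Since c = t^2 + t modulo 2, the form factors as
(x + t y) (x + (t + 1) y). *)
Lemma binary_form_root t c : t ^+ 2 + t + c = 0 ->
  isometric (binary_form 1 c) (@hyperbolic_plane F).
Proof.
move=> tc; have {tc}-> : c = t ^+ 2 + t.
  transitivity (t ^+ 2 + t + c + (t ^+ 2 + t) - 2%:R * (t ^+ 2 + t)); first by ring.
  by rewrite tc two0; ring.
apply: (isometricI
  (f := fun x : plane => (x.1 + t * x.2, x.1 + (t + 1) * x.2) : plane)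
  (g := fun x : plane => (x.1 - t * (x.2 - x.1), x.2 - x.1) : plane)).
- by move=> c' x y /=; congr (_, _) => /=; rewrite -?[_ *: _]/(_ * _); ring.
- by case=> x y /=; congr (_, _); ring.
- by case=> x y /=; congr (_, _); ring.
- by case=> x y /=; rewrite /binary_form /hyperbolic_plane /=; ring: two0.
Qed.

Lemma binary_form_isotropic c x : binary_form 1 c x = 0 -> x != 0 ->
  exists t, t ^+ 2 + t + c = 0.
Proof.
case: x => x y; rewrite /binary_form /= mul1r.
have [->|y0] := eqVneq y 0.
  rewrite mulr0 expr0n mulr0 !addr0 => /eqP; rewrite sqrf_eq0 => /eqP->.
  by rewrite eqxx.
move=> xy _; exists (x / y); apply: (mulIf (expf_neq0 2 y0)).
by rewrite mul0r -[RHS]xy; field.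
Qed.

Section Split.

Variables (U : vectType F) (q : U -> F) (e f : U).

Definition orth2 : {vspace U} :=
  lker (linfun (fun x => (polar q x e, polar q x f) : (F^o * F^o)%type)).

Hypothesis qq : quadratic_form q.

Lemma mem_orth2 x : (x \in orth2) = (polar q x e == 0) && (polar q x f == 0).
Proof.
pose k x := (polar q x e, polar q x f) : (F^o * F^o)%type.
have lk : linear k by move=> a u v; rewrite /k !polarP.
pose h : {linear U -> (F^o * F^o)%type} :=
  HB.pack k (GRing.isLinear.Build F U _ *:%R k lk).
by rewrite memv_ker -[fun x => _]/(h : U -> _) lfunE.
Qed.

Lemma orth2P (c : subvs_of orth2) :
  polar q (vsval c) e = 0 /\ polar q (vsval c) f = 0.
Proof. by have := subvsP c; rewrite mem_orth2 => /andP[/eqP-> /eqP->]. Qed.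

(** In characteristic 2 the polar form is alternating, so the components of u
along e and f are b(u, f) and b(u, e). *)
Lemma split_plane : polar q e f = 1 ->
  isometric (orthogonal_sum (binary_form (q e) (q f))
                            (fun c : subvs_of orth2 => q (vsval c))) q.
Proof.
move=> ef; have ee := polar_alt e qq; have ff := polar_alt f qq.
have fe : polar q f e = 1 by rewrite polarC.
pose p u := u - polar q u f *: e - polar q u e *: f.
have pP u : p u \in orth2.
  rewrite mem_orth2 /p !polarDl // -!scaleNr !polarZl // ee ff ef fe.
  by apply/andP; split; apply/eqP; ring.
apply: (isometricI
  (f := fun x : ((F^o * F^o) * subvs_of orth2)%type =>
          x.1.1 *: e + x.1.2 *: f + vsval x.2)
  (g := fun u => ((polar q u f, polar q u e) : (F^o * F^o)%type, vsproj orth2 (p u)))).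
- move=> a x y /=; rewrite !scalerDr !scalerDl !scalerA.
  by rewrite (addrACA (_ *: e) _ (_ *: f)) (addrACA _ _ (a *: vsval _)).
- case=> [[x y] c]; have [ce cf] := orth2P c.
  rewrite /= /p !polarDl // !polarZl // ee ff ef fe ce cf.
  rewrite !mulr0 !mulr1 !addr0 add0r; congr (_, _).
  rewrite -[RHS]vsvalK; congr vsproj.
  by rewrite -addrA -opprD [_ + vsval c]addrC addrK.
- by move=> u /=; rewrite vsprojK // /p addrC -[_ - _ - _]addrA -opprD subrK.
- move=> [[x y] c]; have [ce cf] := orth2P c.
  rewrite /orthogonal_sum /binary_form /= quadD // quadD // !(quadZ qq).
  rewrite polarDl // !polarZl // polarZr // ef !(polarC q _ (vsval c)) ce cf.
  by ring.
Qed.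

End Split.

Lemma nonsingular_partner V (q : V -> F) e : nonsingular q -> e != 0 ->
  exists f, polar q e f = 1.
Proof.
move=> [qq qn] e0.
case: (altP (@allP _ (fun x => polar q e x == 0) (vbasis {:V}))) => [h|].
  case/negP: e0; apply/eqP/qn => y; rewrite (coord_vbasis (memvf y)).
  elim/big_rec: _ => [|i x _ IH]; first by rewrite polarC polar0l.
  rewrite polarDr // polarZr // IH addr0.
  by rewrite (eqP (h _ _)) ?mulr0 // -tnth_nth mem_tnth.
case/allPn=> x _ ex; exists ((polar q e x)^-1 *: x).
by rewrite polarZr // mulVf.
Qed.

(** The map s sends a symplectic pair e, f of q to a symplectic pair of q' with
values q(e)^2 and q(f)^2, and sends the complement of the former to that of
the latter.  Two spaces are allowed because these complements differ even when
the original spaces coincide, which is what lets the induction proceed.  The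
two pairs split off the planes [[q(e), q(f)]] and [[q(e)^2, q(f)^2]]. *)
Lemma frobenius_classification n U U' (q : U -> F) (q' : U' -> F) (s : U -> U') :
    nonsingular q -> nonsingular q' -> dim U = n -> dim U' = n ->
    (forall x, q' (s x) = q x ^+ 2) ->
    (forall x y, polar q' (s x) (s y) = polar q x y ^+ 2) ->
  n = 0%N \/ exists c m,
    isometric (orthogonal_sum (@hyperbolic_space F m) (binary_form 1 c)) q'.
Proof.
elim/ltn_ind: n => n IHn in U U' q q' s *.
move=> qns qns' Un Un' sq sp; have [qq _] := qns; have [qq' _] := qns'.
have [|n0] := eqVneq n 0%N; [by left|right].
have e0 : vpick {:U} != 0 by rewrite vpick0 -dimv_eq0 dimvf Un.
have [f ef] := nonsingular_partner qns e0; set e := vpick _ in ef.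
have ef' : polar q' (s e) (s f) = 1 by rewrite sp ef expr1n.
have sqe := split_plane qq ef; have sqe' := split_plane qq' ef'.
rewrite !sq in sqe'.
pose r (c : subvs_of (orth2 q e f)) := q (vsval c).
pose r' (c : subvs_of (orth2 q' (s e) (s f))) := q' (vsval c).
have rq : quadratic_form r.
  apply: quadratic_formI => [a x|a x y z]; first by rewrite /r linearZ quadZ.
  by rewrite /polar /r !linearD !linearZ /= -![_ - _ - _]/(polar q _ _) polarP.
have rq' : quadratic_form r'.
  apply: quadratic_formI => [a x|a x y z]; first by rewrite /r' linearZ quadZ.
  by rewrite /polar /r' !linearD !linearZ /= -![_ - _ - _]/(polar q' _ _) polarP.
have [_ rns] := (sum_nonsingular (binary_form_quad _ _) rq).1
  (isometric_nonsingular (isometric_sym sqe) qns).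
have [_ rns'] := (sum_nonsingular (binary_form_quad _ _) rq').1
  (isometric_nonsingular (isometric_sym sqe') qns').
have rd : (2 + dim (subvs_of (orth2 q e f)) = n)%N by rewrite -Un -(isometric_dim sqe).
have rd' : (2 + dim (subvs_of (orth2 q' (s e) (s f))) = n)%N.
  by rewrite -Un' -(isometric_dim sqe').
have rs x : x \in orth2 q e f -> s x \in orth2 q' (s e) (s f).
  rewrite !mem_orth2 // !sp => /andP[/eqP-> /eqP->].
  by rewrite expr0n eqxx.
have lt_n : (dim (subvs_of (orth2 q e f)) < n)%N by rewrite -rd add2n ltnS.
have dr : dim (subvs_of (orth2 q' (s e) (s f))) = dim (subvs_of (orth2 q e f)).
  by apply: (@addnI 2); rewrite rd rd'.
have IH := IHn _ lt_n _ _ r r' (fun x => Subvs (rs _ (subvsP x))) rns rns' erefl dr.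
have sqab := isometric_trans
  (isometric_sum (binary_form_squares (q e) (q f)) (isometric_refl r')) sqe'.
case: IH => [x|x y|d0|[c [m rc]]]; first exact: sq.
- by rewrite /polar /r' /r !linearD /= -![_ - _ - _]/(polar _ _ _) sp.
- exists (q e * q f), 0%N; apply: isometric_trans sqab.
  apply: isometric_trans (isometric_sumC _ _) _.
  apply: isometric_sum (isometric_refl _) _.
  apply: isometric_dim0 => //; first exact: hyperbolic_space_quad.
    by rewrite hyperbolic_space_dim.
  by rewrite dr.
- exists (q e * q f + c), m.+1; apply: isometric_trans sqab.
  apply: isometric_trans (isometric_sum (isometric_refl _) rc).
  set b := binary_form 1 (q e * q f).
  apply: isometric_trans (isometric_sum (isometric_refl _) (isometric_sumC _ _)).
  apply: isometric_trans (isometric_sym (isometric_sumA _ _ _)).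
  apply: isometric_trans
    (isometric_sum (binary_form_add _ _) (isometric_refl _)).
  apply: isometric_trans (isometric_sumA _ _ _).
  apply: isometric_trans (isometric_sumC _ _) _.
  apply: isometric_sum (isometric_refl _) (isometric_sym _).
  exact: hyperbolic_spaceS.
Qed.

End CharTwo.

(** * First and second coefficients of characteristic polynomials *)

Section ReversedCharPoly.

Variable (F : fieldType).

Definition rev_char_poly n (A : 'M[F]_n) : {poly F} :=
  \det (1%:M - 'X *: map_mx polyC A).

(** In the field of fractions, det(1 - X A) = X^n det(X^-1 - A). *)
Lemma rev_char_polyE n (A : 'M[F]_n) :
  rev_char_poly A = \poly_(i < n.+1) (char_poly A)`_(n - i).
Proof.
apply/eqP; rewrite -tofrac_eq; apply/eqP; set t := tofrac ('X : {poly F}).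
have t0 : t != 0 by rewrite tofrac_eq0 polyX_eq0.
pose c : {rmorphism F -> {fraction {poly F}}} := (@tofrac {poly F}) \o polyC.
have -> : tofrac (rev_char_poly A) = t ^+ n * (map_poly c (char_poly A)).[t^-1].
  rewrite map_char_poly -horner_evalE /char_poly -[horner_eval _ _]det_map_mx.
  rewrite -detZ /rev_char_poly -det_map_mx.
  congr (\det _); apply/matrixP=> i j; rewrite !mxE /= rmorphB rmorphM rmorph_nat.
  rewrite horner_evalE !hornerE hornerMn hornerX mulrBr.
  by rewrite mulrnAr mulfV.
rewrite (@horner_coef_wide _ n.+1); last first.
  by rewrite size_map_poly size_char_poly.
rewrite poly_def (rmorph_sum (@tofrac {poly F})) mulr_sumr.
rewrite (reindex_inj rev_ord_inj); apply: eq_bigr => i _ /=.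
rewrite subSS coef_map /= -mul_polyC rmorphM rmorphXn mulrCA; congr (_ * _).
rewrite -/t exprVn; apply: (mulIf (expf_neq0 (n - i) t0)).
by rewrite mulfVK ?expf_neq0 // -exprD subnKC // -ltnS.
Qed.

Lemma coef_rev_char_poly n (A : 'M[F]_n) k :
  (rev_char_poly A)`_k = if (k <= n)%N then (char_poly A)`_(n - k) else 0.
Proof. by rewrite rev_char_polyE coef_poly ltnS. Qed.

Lemma rev_char_poly0 n (A : 'M[F]_n) : (rev_char_poly A)`_0 = 1.
Proof.
rewrite coef_rev_char_poly // subn0.
by have /eqP := char_poly_monic A; rewrite lead_coefE size_char_poly.
Qed.

Lemma rev_char_poly1 n (A : 'M[F]_n) : (rev_char_poly A)`_1 = - \tr A.
Proof.
case: n A => [|n] A; last first.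
  by rewrite coef_rev_char_poly // subn1 char_poly_trace.
by rewrite /rev_char_poly det_mx00 coefC /= /mxtrace big_ord0 oppr0.
Qed.

(** Determinants are polynomial in the entries, hence respect congruences. *)
Lemma dvdp_det n (m : {poly F}) (A B : 'M[{poly F}]_n) :
  (forall i j, m %| A i j - B i j) -> m %| \det A - \det B.
Proof.
move=> AB; rewrite /determinant -sumrB.
apply: (big_ind (fun p => m %| p)) => [|p q|s _]; first exact: dvdp0.
  exact: dvdp_add.
rewrite -mulrBr dvdp_mull //.
apply: (big_ind2 (fun p q => m %| p - q)) => [|p p' q q' pp' qq'|i _].
- by rewrite subrr dvdp0.
- have -> : p * q - p' * q' = (p - p') * q + p' * (q - q') by ring.
  by rewrite dvdp_add ?(dvdp_mulr _ pp') // dvdp_mull.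
- exact: AB.
Qed.

Lemma coef_dvdp_Xn k m (p q : {poly F}) : 'X^m %| p - q -> (k < m)%N -> p`_k = q`_k.
Proof.
move=> /dvdpP[r pq] km; apply/eqP; rewrite -subr_eq0 -coefB pq.
by rewrite coefMXn km.
Qed.

Lemma coef2M (p q : {poly F}) : (p * q)`_2 = p`_0 * q`_2 + p`_1 * q`_1 + p`_2 * q`_0.
Proof. by rewrite coefM !big_ord_recr big_ord0 /= add0r. Qed.

Lemma det_1_add_Xsqr n (A : 'M[F]_n) :
  \det (1%:M + 'X^2 *: map_mx polyC A) = rev_char_poly (- A) \Po 'X^2.
Proof.
pose f : {rmorphism {poly F} -> {poly F}} := comp_poly 'X^2.
rewrite -[RHS]/(f _) -det_map_mx; congr (\det _); apply/matrixP=> i j.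
rewrite !mxE rmorphB rmorphM /= rmorph_nat comp_polyX comp_polyC.
by rewrite polyCN mulrN opprK.
Qed.

(** Compare the coefficients of X^2 in
(1 - X A) (1 - X B) = (1 - X (A + B)) (1 + X^2 A B) modulo X^3. *)
Lemma rev_char_polyD2 n (A B : 'M[F]_n) :
  (rev_char_poly (A + B))`_2 + \tr (A *m B) =
  (rev_char_poly A)`_2 + (rev_char_poly B)`_2 + \tr A * \tr B.
Proof.
pose c := map_mx (@polyC F) : 'M_n -> 'M_n.
pose P := 1%:M - 'X *: c A - 'X *: c B + 'X^2 *: (c A *m c B).
have ABE : rev_char_poly A * rev_char_poly B = \det P.
  rewrite -det_mulmx mulmxBl mul1mx mulmxBr mulmx1; congr (\det _).
  rewrite -scalemxAl -scalemxAr scalerA /P -expr2 opprB addrA.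
  by rewrite addrAC [1%:M + _ - _]addrAC -addrA.
pose Q := (1%:M - 'X *: c (A + B)) *m (1%:M + 'X^2 *: c (A *m B)).
have QE : \det Q = rev_char_poly (A + B) * (rev_char_poly (- (A *m B)) \Po 'X^2).
  by rewrite det_mulmx det_1_add_Xsqr.
have PQ : 'X^3 %| \det P - \det Q.
  apply: dvdp_det => i j.
  pose C := c (A + B) *m c (A *m B).
  have -> : Q = 1%:M - 'X *: (c A + c B) + 'X^2 *: (c A *m c B) - 'X^3 *: C.
    rewrite /Q mulmxDr mulmx1 mulmxBl mul1mx -scalemxAl -scalemxAr scalerA -exprS.
    by rewrite -/C /c map_mxD map_mxM addrA.
  have -> : P i j - (1%:M - 'X *: (c A + c B) + 'X^2 *: (c A *m c B) - 'X^3 *: C) i j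
      = 'X^3 * C i j.
    by rewrite /P; move: (c A *m c B) C => D C'; rewrite !mxE; ring.
  by rewrite dvdp_mulr.
have := coef_dvdp_Xn PQ (isT : (2 < 3)%N); rewrite QE -ABE !coef2M.
rewrite (coef_comp_poly_Xn _ 0) // (coef_comp_poly_Xn _ 1) // (coef_comp_poly_Xn _ 2) //=.
rewrite divnn /=.
have s1 : (rev_char_poly (- (A *m B)))`_1 = \tr (A *m B).
  by rewrite rev_char_poly1 raddfN opprK.
move: (rev_char_poly0 A) (rev_char_poly1 A) (rev_char_poly0 B) (rev_char_poly1 B)
  (rev_char_poly0 (A + B)) (rev_char_poly0 (- (A *m B))) s1.
move: (rev_char_poly A) (rev_char_poly B) (rev_char_poly (A + B))
  (rev_char_poly (- (A *m B))) (\tr A) (\tr B) (\tr (A *m B)).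
move=> p q r s a b t -> -> -> -> -> -> -> h.
have -> : r`_2 + t = 1 * t + r`_1 * 0 + r`_2 * 1 by ring.
by rewrite -h; ring.
Qed.

Lemma rev_char_polyZ n (A : 'M[F]_n) a k :
  (rev_char_poly (a *: A))`_k = a ^+ k * (rev_char_poly A)`_k.
Proof.
have -> : rev_char_poly (a *: A) = rev_char_poly A \Po (a *: 'X).
  pose f : {rmorphism {poly F} -> {poly F}} := comp_poly (a *: 'X).
  rewrite -[RHS]/(f _) -det_map_mx; congr (\det _); apply/matrixP=> i j.
  rewrite !mxE rmorphB polyCM [f (_ * _)]rmorphM /= rmorph_nat comp_polyX comp_polyC.
  by rewrite mulrCA mulrA mul_polyC.
rewrite coef_comp_poly; under eq_bigr => i _ do
  rewrite exprZn coefZ coefXn.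
have [ks|ks] := ltnP k (size (rev_char_poly A)).
  rewrite (bigD1 (Ordinal ks)) //= eqxx mulr1 mulrC big1 ?addr0 // => i ik.
  by rewrite eq_sym (negPf (ik : (i : nat) != k)) !mulr0.
rewrite (nth_default _ ks) mulr0 big1 // => i _.
by rewrite gtn_eqF ?mulr0 // (leq_trans (ltn_ord i)).
Qed.

Section Char2.
Hypothesis charF2 : 2%N \in [pchar F].
Let two0 : 2%:R = 0 :> F := pcharf0 charF2.

(** Squaring is additive in characteristic 2. *)
Lemma coef_sqr_pchar2 (p : {poly F}) k : (p ^+ 2)`_(k.*2) = p`_k ^+ 2.
Proof.
elim/poly_ind: p k => [|p c IH] k; first by rewrite !expr0n /= !coef0 expr0n.
have -> : (p * 'X + c%:P) ^+ 2 = p ^+ 2 * 'X^2 + (c ^+ 2)%:P + (p * 'X * c%:P) *+ 2.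
  by rewrite rmorphXn /=; ring.
rewrite -mulr_natr -polyC_natr two0 mulr0 addr0 !coefE.
case: k => [|k]; first by rewrite !add0r.
by rewrite doubleS /= !addr0 subn2 /= IH.
Qed.

(** In characteristic 2, (1 - X A)^2 = 1 - X^2 A^2. *)
Lemma rev_char_poly_sqr n (A : 'M[F]_n) k :
  (rev_char_poly (A *m A))`_k = (rev_char_poly A)`_k ^+ 2.
Proof.
rewrite -coef_sqr_pchar2.
suff -> : rev_char_poly A ^+ 2 = rev_char_poly (A *m A) \Po 'X^2.
  by rewrite coef_comp_poly_Xn // -muln2 dvdn_mull // mulnK.
pose c := map_mx (@polyC F) : 'M_n -> 'M_n.
rewrite -[A *m A]opprK -det_1_add_Xsqr expr2 -det_mulmx; congr (\det _).
rewrite mulmxBl mul1mx mulmxBr mulmx1 -scalemxAl -scalemxAr scalerA.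
apply/matrixP=> i j; rewrite map_mxN map_mxM -expr2 scalerN.
move: (_ *m _) => D; rewrite !mxE.
have two0' : 2%:R = 0 :> {poly F} by rewrite -polyC_natr two0.
set x := 'X; set y := (A i j)%:P; set z := D i j; set u := _%:R.
by rewrite -[RHS]addr0 -(mul0r (x ^+ 2 * z - x * y)) -two0'; ring.
Qed.

End Char2.

Lemma deriv_prod (I : finType) (f : I -> {poly F}) :
  (\prod_i f i)^`() = \sum_i (f i)^`() * \prod_(j | j != i) f j.
Proof.
have key (r : seq I) : uniq r ->
    (\prod_(i <- r) f i)^`() = \sum_(i <- r) (f i)^`() * \prod_(j <- r | j != i) f j.
  elim: r => [|i r IHr] /=; first by rewrite !big_nil derivC.
  case/andP=> ir ur; rewrite !big_cons derivM IHr // eqxx /=; congr (_ * _ + _).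
    rewrite big_seq [RHS]big_seq_cond; apply: eq_bigl => j.
    by case: eqP => [->|_]; rewrite ?(negPf ir) ?andbT.
  rewrite mulr_sumr big_seq [RHS]big_seq; apply: eq_bigr => j jr.
  rewrite big_cons ifT; first exact: mulrCA.
  by apply: contraNneq ir => ->.
by rewrite (key _ (index_enum_uniq I)).
Qed.

Lemma deriv_det n (A : 'M[{poly F}]_n) :
  (\det A)^`() = \sum_i \sum_j (A i j)^`() * cofactor A i j.
Proof.
pose B i := \matrix_(k, l) (if k == i then (A k l)^`() else A k l).
transitivity (\sum_i \det (B i)).
  rewrite /determinant exchange_big /= linear_sum; apply: eq_bigr => s _ /=.
  rewrite -mulr_sumr.
  have -> (p : {poly F}) : ((-1) ^+ perm.odd_perm s * p)^`() = (-1) ^+ perm.odd_perm s * p^`().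
    by case: (perm.odd_perm s); rewrite ?expr0 ?mul1r // expr1 !mulN1r derivN.
  congr (_ * _); rewrite deriv_prod; apply: eq_bigr => i _.
  rewrite [RHS](bigD1 i) //= mxE eqxx; congr (_ * _).
  by apply: eq_bigr => j ji; rewrite mxE (negPf ji).
apply: eq_bigr => i _; rewrite (expand_det_row _ i); apply: eq_bigr => j _.
rewrite mxE eqxx; congr (_ * ((-1) ^+ _ * \det _)).
by apply/matrixP=> k l; rewrite !mxE eq_sym (negPf (neq_lift _ _)).
Qed.

Lemma deriv_char_poly n (A : 'M[F]_n) :
  (char_poly A)^`() = \tr (\adj (char_poly_mx A)).
Proof.
rewrite deriv_det; apply: eq_bigr => i _; rewrite (bigD1 i) //= big1 ?addr0.
  by rewrite !mxE eqxx derivB derivX derivC subr0 mul1r.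
by move=> j ji; rewrite !mxE eq_sym (negPf ji) sub0r derivN derivC oppr0 mul0r.
Qed.

Lemma Cayley_Hamilton_sum n (A : 'M[F]_n) :
  \sum_(k < n.+1) (char_poly A)`_k *: (A ^+ k : 'M_n) = 0.
Proof.
case: n A => [|n] A; first by apply/matrixP=> -[].
rewrite -[RHS](Cayley_Hamilton A) -[X in horner_mx A X]coefK size_char_poly.
rewrite poly_def linear_sum; apply: eq_bigr => k _.
by rewrite linearZ rmorphXn /= horner_mx_X.
Qed.

(** The derivative of det(X - A) is the trace of the adjugate of X - A.  As
chi(A) = 0, expanding chi(X) - chi(A) expresses this adjugate as a combination
of the powers of A with polynomial coefficients. *)
Lemma deriv_char_poly_trace0 n (A : 'M[F]_n) :
  (forall k, \tr (A ^+ k : 'M_n) = 0) -> (char_poly A)^`() = 0.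
Proof.
move=> A0; rewrite deriv_char_poly.
pose x : 'M[{poly F}]_n := 'X%:M; pose y : 'M[{poly F}]_n := map_mx (@polyC F) A.
have xE k : x ^+ k = ('X^k)%:M.
  elim: k => [|k IH]; first by rewrite !expr0.
  by rewrite !exprS IH [RHS]scalar_mxM.
have yE k : y ^+ k = map_mx (@polyC F) (A ^+ k : 'M_n).
  elim: k => [|k IH]; first by rewrite !expr0 [RHS]map_mx1.
  by rewrite !exprS IH; apply/esym/(map_mxM _ A).
pose S k : 'M[{poly F}]_n := \sum_(i < k) x ^+ (k.-1 - i) * y ^+ i.
have SE k : (x - y) *m S k = x ^+ k - y ^+ k.
  by have xy : GRing.comm x y := esym (scalar_mxC _ _); rewrite (subrXX_comm k xy).
pose Q : 'M[{poly F}]_n := \sum_(k < n.+1) ((char_poly A)`_k)%:P *: S k.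
have xyQ : char_poly_mx A *m Q = (char_poly A)%:M.
  rewrite mulmx_sumr.
  under eq_bigr => k _ do rewrite -scalemxAr SE scalerBr xE yE -map_mxZ.
  rewrite sumrB -(raddf_sum (map_mx (@polyC F))) Cayley_Hamilton_sum raddf0 subr0.
  under eq_bigr => k _ do rewrite scale_scalar_mx mul_polyC.
  by rewrite -raddf_sum -[in RHS](coefK (char_poly A)) size_char_poly poly_def.
have Qadj : Q = \adj (char_poly_mx A).
  have chi0 : char_poly A != 0 by rewrite monic_neq0 ?char_poly_monic.
  have : \adj (char_poly_mx A) *m (char_poly_mx A *m Q) =
         char_poly A *: \adj (char_poly_mx A).
    by rewrite xyQ mul_mx_scalar.
  rewrite mulmxA mul_adj_mx mul_scalar_mx => /matrixP QE; apply/matrixP=> i j.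
  by apply: (mulfI chi0); have := QE i j; rewrite [LHS]mxE [RHS]mxE.
rewrite -Qadj /Q linear_sum big1 // => k _; rewrite linearZ /= linear_sum.
rewrite big1 ?mulr0 // => i _.
by rewrite xE yE [_ * _]mul_scalar_mx linearZ /= trace_map_mx A0 mulr0.
Qed.

End ReversedCharPoly.

(** * Second trace forms *)

Section TraceForm.

Variables (F : fieldType) (E : fieldExtType F).

Let n := \dim {:E}.
Local Notation T := (@char_coef F E 1).
Local Notation T2 := (@char_coef F E 2).

Lemma mul_mx_is_linear : linear (@mul_mx F E).
Proof. by move=> c a b; rewrite /mul_mx amull_is_linear passmx.mxof_linear. Qed.

HB.instance Definition _ :=
  GRing.isLinear.Build F E 'M[F]_n *:%R (@mul_mx F E) mul_mx_is_linear.

Lemma mul_mxM (a b : E) : mul_mx (a * b) = mul_mx a *m mul_mx b.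
Proof.
rewrite /mul_mx -passmx.mxof_comp ?vbasisP // mulrC; congr passmx.mxof.
by apply/lfunP=> x; rewrite comp_lfunE !lfunE /= mulrA.
Qed.

Lemma mul_mx1 : mul_mx (1 : E) = 1%:M.
Proof. by rewrite /mul_mx amull1 passmx.mxof1 // (basis_free (vbasisP _)). Qed.

Lemma mul_mxX (a : E) k : mul_mx (a ^+ k) = (mul_mx a ^+ k : 'M_n).
Proof. by elim: k => [|k IH]; rewrite ?mul_mx1 // !exprS mul_mxM IH. Qed.

Lemma char_coefE i (a : E) : char_coef i a = (-1) ^+ i * (rev_char_poly (mul_mx a))`_i.
Proof. by rewrite coef_rev_char_poly /char_coef; case: ifP; rewrite ?mulr0. Qed.

Lemma char_coef1D (x y : E) : T (x + y) = T x + T y.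
Proof. by rewrite !char_coef1E linearD linearD. Qed.

Lemma char_coef1Z c (x : E) : T (c *: x) = c * T x.
Proof. by rewrite !char_coef1E linearZ linearZ. Qed.

Lemma char_coef11 : T 1 = n%:R.
Proof. by rewrite char_coef1E mul_mx1 mxtrace1. Qed.

Lemma char_coef2Z c (x : E) : T2 (c *: x) = c ^+ 2 * T2 x.
Proof. by rewrite !char_coefE linearZ rev_char_polyZ mulrCA. Qed.

Lemma polar_char_coef2 (x y : E) : T2 (x + y) - T2 x - T2 y = T x * T y - T (x * y).
Proof.
rewrite !char_coef1E mul_mxM !char_coefE linearD -signr_odd expr0 !mul1r.
have /(canRL (addrK _)) -> := rev_char_polyD2 (mul_mx x) (mul_mx y).
move: (rev_char_poly (mul_mx x))`_2 (rev_char_poly (mul_mx y))`_2 => a b.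
move: (\tr (mul_mx x)) (\tr (mul_mx y)) (\tr (_ *m _)) => c d e.
by ring.
Qed.

Lemma root_char_poly (z : E) :
  root (map_poly (in_alg E) (char_poly (mul_mx z))) z.
Proof.
have mul_mx_inj a : mul_mx a = 0 -> a = 0 :> E.
  move/eqP; rewrite /mul_mx passmx.mxof_eq0 ?vbasisP // => /eqP a0.
  by have /lfunP/(_ 1) := a0; rewrite !lfunE /= mulr1.
apply/rootP/mul_mx_inj; rewrite -(Cayley_Hamilton_sum (mul_mx z)).
rewrite horner_coef size_map_poly size_char_poly linear_sum.
apply: eq_bigr => k _.
by rewrite coef_map /= mulr_algl linearZ /= mul_mxX.
Qed.

Lemma minPoly_primitive (z : E) (f : {poly F}) :
    <<1; z>>%VS = fullv -> f \is monic -> size f = n.+1 ->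
    root (map_poly (in_alg E) f) z ->
  minPoly 1 z = map_poly (in_alg E) f.
Proof.
move=> Ez fm fn fz; apply/eqP.
rewrite -eqp_monic ?monic_minPoly ?map_monic // -dvdp_size_eqp.
  by rewrite size_minPoly size_map_poly fn /n -Ez dim_Fadjoin dimv1 muln1.
by apply: minPoly_dvdp; rewrite ?alg_polyOver.
Qed.

Section Separable.

Hypothesis sepE : separable 1%VS {:E}.

(** If the trace vanished, the minimal polynomial of a primitive element, which
is its characteristic polynomial, would have derivative 0. *)
Lemma separable_trace_neq0 : ~ (forall x, T x = 0).
Proof.
move=> T0; have [z Ez] : exists z : E, <<1; z>>%VS = fullv.
  exists (separable_generator 1%VS {:E}).
  exact/esym/(@eq_adjoin_separable_generator F E (aspacef E) (1%AS) sepE (subvf _)).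
have p0 : (char_poly (mul_mx z))^`() = 0.
  by apply: deriv_char_poly_trace0 => k; rewrite -mul_mxX -char_coef1E.
have := separable_root_der 1 z.
rewrite (minPoly_primitive Ez (char_poly_monic _) (size_char_poly _) (root_char_poly z)).
rewrite deriv_map p0 rmorph0 root0 addbT => /negP[].
by move/separableP: sepE; apply; rewrite memvf.
Qed.

Lemma trace_nondegenerate (x : E) : (forall y, T (x * y) = 0) -> x = 0.
Proof.
move=> xT; have [//|x0] := eqVneq x 0.
by case: separable_trace_neq0 => z; rewrite -(divfK x0 z) mulrC.
Qed.

End Separable.

Section Char2.
Hypothesis charF2 : 2%N \in [pchar F].
Let two0 : 2%:R = 0 :> F := pcharf0 charF2.

Lemma char_coef_sqr i (x : E) : char_coef i (x ^+ 2) = char_coef i x ^+ 2.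
Proof.
rewrite !char_coefE expr2 mul_mxM rev_char_poly_sqr // exprMn -exprM mulnC exprM.
rewrite sqrrN expr1n; congr (_ * _).
have -> : -1 = 1 :> F by apply: oppr_pchar2.
by rewrite expr1n.
Qed.

End Char2.

Lemma mem_second_trace_space (x : E) :
  (x \in second_trace_space E) = ~~ odd n || (T x == 0).
Proof.
rewrite /second_trace_space -/n; case: ifP => _ /=; first exact: mem_trace_kernel.
exact: memvf.
Qed.

Lemma polar_second_trace x y : polar (@second_trace_form F E) x y =
  T (vsval x) * T (vsval y) - T (vsval x * vsval y).
Proof. by rewrite -polar_char_coef2 /polar /second_trace_form linearD. Qed.

Lemma second_trace_quad : quadratic_form (@second_trace_form F E).
Proof.
apply: quadratic_formI => [a x|a x y z].
  by rewrite /second_trace_form linearZ char_coef2Z.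
rewrite !polar_second_trace linearD linearZ /= !mulrDl -scalerAl.
rewrite !char_coef1D !char_coef1Z.
move: (T (vsval x)) (T (vsval y)) (T (vsval z)) (T (_ * _)) (T (_ * _)).
move=> tx ty tz txz tyz.
by ring.
Qed.

(** In even degree T_1(1) = 0, so pairing with 1 puts a radical vector x in the
kernel of T_1; in odd degree T_1(1) = 1, and E is the sum of F and the kernel
of T_1.  Either way x is orthogonal to all of E for the trace form. *)
Lemma second_trace_nonsingular : 2%N \in [pchar F] -> separable 1%VS {:E} ->
  nonsingular (@second_trace_form F E).
Proof.
move=> F2 sepE; split; first exact: second_trace_quad.
have n2 : n%:R = (odd n)%:R :> F.
  by rewrite -{1}(odd_double_half n) natrD -muln2 natrM (pcharf0 F2) mulr0 addr0.
move=> x x0; apply: val_inj; apply: (trace_nondegenerate sepE) => z /=.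
have xP y (yP : y \in second_trace_space E) : T (vsval x) * T y = T (vsval x * y).
  by have /eqP := x0 (Subvs yP); rewrite polar_second_trace subr_eq0 => /eqP.
have Tx : T (vsval x) = 0.
  have := subvsP x; rewrite mem_second_trace_space.
  case: (boolP (odd n)) => /= [_ /eqP//|on _].
  have := xP 1; rewrite mem_second_trace_space on /= => /(_ isT).
  by rewrite mulr1 char_coef11 n2 (negPf on) mulr0.
have zP : z - (odd n)%:R *: (T z *: 1) \in second_trace_space E.
  rewrite mem_second_trace_space; case: (odd n) n2 => //= n2.
  rewrite scale1r -scaleNr char_coef1D char_coef1Z char_coef11 n2.
  by rewrite mulr1 subrr.
have := xP _ zP; rewrite Tx mul0r mulrBr -!scalerAr mulr1 -scaleN1r.
by rewrite char_coef1D !char_coef1Z Tx !mulr0 addr0 => <-.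
Qed.

(** Frobenius preserves the space of the second trace form. *)
Lemma second_trace_classification : 2%N \in [pchar F] -> separable 1%VS {:E} ->
  dim (subvs_of (second_trace_space E)) = 0%N \/ exists c m,
    isometric (orthogonal_sum (@hyperbolic_space F m) (binary_form 1 c))
      (@second_trace_form F E).
Proof.
move=> F2 sepE.
have sP x : x \in second_trace_space E -> x ^+ 2 \in second_trace_space E.
  rewrite !mem_second_trace_space char_coef_sqr //.
  by case/orP=> [->|/eqP->] //; rewrite expr0n eqxx orbT.
have ns := second_trace_nonsingular F2 sepE.
apply: (frobenius_classification F2 (s := fun x => Subvs (sP _ (subvsP x))) ns ns) => //.
  by move=> x; rewrite /second_trace_form /= char_coef_sqr.
move=> x y; rewrite !polar_second_trace /= -exprMn !char_coef_sqr //.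
have two0 := pcharf0 F2.
set a := T _; set b := T _; set c := T _.
by rewrite -[LHS]addr0 -(mul0r (c ^+ 2 - a * b * c)) -two0; ring.
Qed.

(** The characteristic polynomial of z is X^2 + X + c, so T_1(z) = 1, T_2(z) = c
and T_2(1) = 1. *)
Lemma second_trace_quadratic z c : 2%N \in [pchar F] ->
    n = 2%N -> <<1; z>>%VS = fullv -> z ^+ 2 + z + c%:A = 0 :> E ->
  isometric (binary_form 1 c) (@second_trace_form F E).
Proof.
move=> F2 n2 Ez zc; have two0 := pcharf0 F2.
pose f : {poly F} := 'X^2 + ('X + c%:P).
have sf : size f = 3%N by rewrite size_polyDl size_polyXn // size_XaddC.
have fm : f \is monic.
  by rewrite monicE lead_coefDl ?size_polyXn ?size_XaddC // lead_coefXn.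
have fz : root (map_poly (in_alg E) f) z.
  rewrite rootE !rmorphD /= map_polyXn map_polyX map_polyC !hornerE /=.
  exact/eqP.
have chi : char_poly (mul_mx z) = f.
  apply: (map_poly_inj (in_alg E)).
  rewrite -(minPoly_primitive Ez (char_poly_monic _) (size_char_poly _) (root_char_poly z)).
  by apply: minPoly_primitive => //; rewrite sf -/n n2.
have Tz : T z = 1.
  rewrite char_coefE coef_rev_char_poly chi -/n n2 /f !coefE /=.
  by rewrite add0r addr0 mulr1 expr1 oppr_pchar2.
have T2z : T2 z = c.
  rewrite char_coefE coef_rev_char_poly chi -/n n2 /f !coefE /=.
  by rewrite !add0r sqrrN expr1n mul1r.
have T21 : T2 1 = 1.
  have nn : (n - 2 = 0)%N by rewrite n2.
  rewrite char_coefE coef_rev_char_poly -/n nn char_poly_det mul_mx1 det1.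
  by rewrite n2 /= !sqrrN !expr1n !mulr1.
have full x : x \in second_trace_space E by rewrite mem_second_trace_space n2.
pose h (x : (F^o * F^o)%type) := vsproj (second_trace_space E) (x.1 *: 1 + x.2 *: z).
apply: (@isometric_embedding _ _ _ _ _ h).
- by move=> a x y; rewrite /h -linearP scalerDr !scalerDl !scalerA addrACA.
- exact: binary_form_nonsingular.
- have -> : dim (subvs_of (second_trace_space E)) = \dim (second_trace_space E) by [].
  by rewrite /second_trace_space -/n n2 /= -/n n2.
- move=> x; rewrite /second_trace_form vsprojK // /binary_form.
  have /(canRL (subrK _))/(canRL (subrK _)) -> := polar_char_coef2 (x.1 *: 1) (x.2 *: z).
  rewrite -scalerAl [1 * (_ *: _)]mul1r !char_coef1Z !char_coef2Z.
  rewrite T21 T2z Tz char_coef11 n2 two0.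
  by rewrite -[RHS]subr0 -(mul0r (x.1 * x.2)) -two0; ring: two0.
Qed.

End TraceForm.

(** * Forms Witt equivalent to a second trace form *)

Section WittEquivalence.

Variable F : fieldType.
Hypothesis charF2 : 2%N \in [pchar F].

Lemma hyperbolic_space_split r k : (r <= k)%N ->
  isometric (@hyperbolic_space F k)
    (orthogonal_sum (@hyperbolic_space F r) (@hyperbolic_space F (k - r))).
Proof.
move=> rk; apply: isometric_sym; have := hyperbolic_spaceD F r (k - r).
by rewrite subnKC.
Qed.

(** Planes can be cancelled unless there are too few of them on the right, and
then counting dimensions gives V = 0, so that q would be hyperbolic. *)
Lemma witt_equivalent_binary (V : vectType F) (q : V -> F) r k c :
    quadratic_form q -> ~ hyperbolic q ->
    isometric (orthogonal_sum (@hyperbolic_space F r) q)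
              (orthogonal_sum (@hyperbolic_space F k) (binary_form 1 c)) ->
  exists m, isometric q (orthogonal_sum (@hyperbolic_space F m) (binary_form 1 c)).
Proof.
move=> qq qnh iq; have dq := isometric_dim iq.
have [rk|kr] := leqP r k.
  exists (k - r)%N; apply: (@witt_cancel F r) => //.
    by apply: sum_quad; [exact: hyperbolic_space_quad|exact: binary_form_quad].
  apply: isometric_trans iq _; apply: isometric_trans (isometric_sym (isometric_sumA _ _ _)).
  exact: isometric_sum (hyperbolic_space_split rk) (isometric_refl _).
case: qnh; exists 0%N; apply: isometric_dim0 => //.
- exact: hyperbolic_space_quad.
- move: dq; rewrite [LHS](_ : _ = dim {ffun 'I_r -> (F^o * F^o)%type} + dim V)%N //.
  rewrite [RHS](_ : _ = dim {ffun 'I_k -> (F^o * F^o)%type} + 2)%N //.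
  rewrite !hyperbolic_space_dim -mulSnr => dq.
  apply/eqP; rewrite -leqn0 -(leq_add2l (r * 2)) addn0 dq leq_mul2r.
  by rewrite kr.
- by rewrite hyperbolic_space_dim.
Qed.

Lemma witt_equivalent_hyperbolic (V : vectType F) (q : V -> F) r k :
    quadratic_form q ->
    isometric (orthogonal_sum (@hyperbolic_space F r) q) (@hyperbolic_space F k) ->
  hyperbolic q.
Proof.
move=> qq iq; have dq := isometric_dim iq.
have rk : (r <= k)%N.
  move: dq; rewrite [LHS](_ : _ = dim {ffun 'I_r -> (F^o * F^o)%type} + dim V)%N //.
  by rewrite !hyperbolic_space_dim -(leq_pmul2r (isT : 0 < 2)%N) => <-; rewrite leq_addr.
exists (k - r)%N; apply: (@witt_cancel F r) => //; first exact: hyperbolic_space_quad.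
exact: isometric_trans iq (hyperbolic_space_split rk).
Qed.

Lemma binary_form_anisotropic c :
    ~ isometric (binary_form 1 c) (@hyperbolic_plane F) ->
  anisotropic (binary_form 1 c).
Proof.
move=> nh x x0; have [//|xn0] := eqVneq x 0; case: nh.
by have [t] := binary_form_isotropic x0 xn0; apply: binary_form_root.
Qed.

Lemma binary_form_of_represents1 (V : vectType F) (q : V -> F) :
    nonsingular q -> dim V = 2%N -> represents q 1 ->
  exists c, isometric (binary_form 1 c) q.
Proof.
move=> qn V2 [x qx]; have [qq _] := qn.
have [|y xy] := nonsingular_partner qn (e := x).
  by apply/eqP=> x0; move/eqP: qx; rewrite x0 quad0 // eq_sym oner_eq0.
exists (q y); apply: (@isometric_embedding _ _ _ _ _
  (fun u : (F^o * F^o)%type => u.1 *: x + u.2 *: y)).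
- by move=> a u v /=; rewrite scalerDr !scalerDl !scalerA addrACA.
- exact: binary_form_nonsingular.
- by rewrite V2.
- move=> u; rewrite quadD // !(quadZ qq) polarZl // polarZr // qx xy /binary_form.
  by ring.
Qed.

(** A root t of X^2 + X + c would make (t, 1) isotropic, and this polynomial has
derivative 1. *)
Lemma artin_schreier_extension c : anisotropic (binary_form 1 c) ->
  exists E : fieldExtType F, separable 1%VS {:E} /\
    isometric (binary_form 1 c) (@second_trace_form F E).
Proof.
move=> can; pose f : {poly F} := 'X^2 + ('X + c%:P).
have sf : size f = 3%N by rewrite size_polyDl size_polyXn // size_XaddC.
have fm : f \is monic.
  by rewrite monicE lead_coefDl ?size_polyXn ?size_XaddC // lead_coefXn.
have firr : irreducible_poly f.
  apply: cubic_irreducible => [|t]; first by rewrite sf.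
  apply/negP=> /rootP; rewrite !hornerE => ft.
  have := can (t, 1); rewrite /binary_form /= mul1r mulr1 expr1n mulr1.
  by move=> /(_ ft) [_] /eqP; rewrite oner_eq0.
have [E dE [z fz Ez]] := irredp_FAdjoin firr; rewrite sf in dE.
exists E; split.
  rewrite -Ez -adjoin_separable_eq.
  have := separable_root_der 1 z; rewrite (minPoly_primitive Ez fm _ fz) ?dE // deriv_map.
  have -> : f^`() = 1.
    by rewrite !derivE -mulr_natr -polyC_natr (pcharf0 charF2) mulr0 add0r addr0.
  by rewrite rmorph1 rootE hornerE oner_eq0 addbF.
apply: (second_trace_quadratic charF2 dE Ez).
by move: fz; rewrite rootE !rmorphD /= map_polyXn map_polyX map_polyC !hornerE /= => /eqP.
Qed.

End WittEquivalence.

Theorem corollary1 (F : fieldType) (charF2 : 2%N \in [pchar F])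
    (V : vectType F) (q : V -> F)
    (q_nonsingular : nonsingular q) (q_not_hyperbolic : ~ hyperbolic q) :
  two_algebraic q <->
  exists (r : nat) (Va : vectType F) (qa : Va -> F),
    [/\ quadratic_form qa, \dim {:Va} = 2%N, anisotropic qa, represents qa 1
      & isometric q (orthogonal_sum (@hyperbolic_space F r) qa)].
Proof.
have [qq _] := q_nonsingular.
split=> [[E [sepE [r [s iq]]]]|[r [Va [qa [qaq dqa qaan qa1 iq]]]]].
  have {}iq : isometric (orthogonal_sum (@hyperbolic_space F r) q)
      (orthogonal_sum (@hyperbolic_space F s) (@second_trace_form F E)).
    apply: isometric_trans (isometric_sumC _ _) _.
    exact: isometric_trans iq (isometric_sumC _ _).
  have [E0|[c [m Ec]]] := second_trace_classification charF2 sepE.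
    case: q_not_hyperbolic; apply: (witt_equivalent_hyperbolic (r := r) (k := s)) => //.
    apply: isometric_trans iq _; apply: isometric_trans (isometric_sumC _ _) _.
    exact: isometric_sum0l (second_trace_quad E) E0.
  have [k qk] : exists k,
      isometric q (orthogonal_sum (@hyperbolic_space F k) (binary_form 1 c)).
    apply: (witt_equivalent_binary charF2 (r := r) (k := s + m)) => //.
    apply: isometric_trans iq _.
    apply: isometric_trans (isometric_sum (isometric_refl _) (isometric_sym Ec)) _.
    apply: isometric_trans (isometric_sumA _ _ _) _.
    exact: isometric_sum (hyperbolic_spaceD _ _ _) (isometric_refl _).
  exists k, (F^o * F^o)%type, (binary_form 1 c); split=> //.
  - exact: binary_form_quad.
  - by rewrite dimvf.
  - apply: (binary_form_anisotropic charF2) => ch.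
    case: q_not_hyperbolic; exists k.+1.
    apply: isometric_trans qk _; apply: isometric_trans (isometric_sumC _ _) _.
    apply: isometric_trans (isometric_sum ch (isometric_refl _)) _.
    exact: hyperbolic_spaceS.
  - by exists (1, 0); rewrite /binary_form /= expr1n mulr0 expr0n mulr0 mulr1 !addr0.
have [_ qan] := (sum_nonsingular (hyperbolic_space_quad F r) qaq).1
  (isometric_nonsingular iq q_nonsingular).
have [|c qac] := binary_form_of_represents1 charF2 qan _ qa1; first by rewrite -dimvf.
have can : anisotropic (binary_form 1 c).
  case: qac => g [g' gK gK'] gq x; rewrite -gq => /qaan gx.
  by apply: (can_inj gK); rewrite gx linear0.
have [E [sepE cE]] := artin_schreier_extension charF2 can.
exists E; split=> //; exists 0%N, r.
apply: isometric_trans (isometric_sym (isometric_sum_hyperbolic0 _)) _.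
apply: isometric_trans iq _; apply: isometric_trans (isometric_sumC _ _) _.
apply: isometric_sum (isometric_refl _).
exact: isometric_trans (isometric_sym qac) cE.
Qed.
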